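(* Let $0<q<1$ and let $n\ge 1$ be an integer. The zeros of $V_n^{(\alpha)}(\cdot;q)$, the polynomial of degree $n$ in the second family of Al-Salam--Carlitz polynomials ($0<\alpha<q^{-1}$), are strictly increasing functions of $\alpha$ on $(0,q^{-1})$.
   Context: The second family of Al-Salam--Carlitz polynomials is given, in the variable $X$ (with $X=x(s)=q^{-s}$), by $$V_n^{(\alpha)}(X;q)=(-\alpha)^nq^{-\binom n2}\,{}_2\phi_0\left(\left.{q^{-n},\,X\atop -}\right|q,\frac{q^n}{\alpha}\right)=(-\alpha)^nq^{-\binom n2}\sum_{k=0}^n\frac{(q^{-n};q)_k(X;q)_k}{(q;q)_k}(-1)^kq^{-\binom k2}\left(\frac{q^n}{\alpha}\right)^k,$$ where $(u;q)_k=\prod_{j=0}^{k-1}(1-uq^j)$. Zeros are zeros in the variable $X$; there are $n$ of them, real and distinct, lying in $(1,\infty)$. The statement refers to each zero (the zeros being arranged in increasing order) as a function of $\alpha$. *)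

(* Defs.v *)
From mathcomp Require Import all_boot all_order all_algebra.
From mathcomp Require Import reals.
From mathcomp.real_closed Require Import polyrcf.

Set Implicit Arguments.
Unset Strict Implicit.
Unset Printing Implicit Defensive.

Import Order.TTheory GRing.Theory Num.Theory.

Local Open Scope ring_scope.

(* The q-Pochhammer symbol (u; q)_k. It is stated over any commutative ring so
   that u can be a scalar or the polynomial variable 'X. *)
Definition qpoch (A : comNzRingType) (q u : A) (k : nat) : A :=
  \prod_(j < k) (1 - u * q ^+ j).

(* V_n^(alpha)(X; q), as a polynomial in X. *)
Definition alSalamCarlitz2 (R : realType) (q : R) (n : nat) (alpha : R) :
    {poly R} :=
  ((- alpha) ^+ n * q ^- 'C(n, 2)) *:
  \sum_(k < n.+1)
    (qpoch q (q ^- n) k / qpoch q q k * (-1) ^+ k * q ^- 'C(k, 2)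
       * (q ^+ n / alpha) ^+ k) *: qpoch q%:P 'X k.

Lemma horner_alSalamCarlitz2 (R : realType) (q : R) n (alpha x : R) :
  (alSalamCarlitz2 q n alpha).[x] =
  (- alpha) ^+ n * q ^- 'C(n, 2) *
  \sum_(k < n.+1)
    qpoch q (q ^- n) k * qpoch q x k / qpoch q q k
      * (-1) ^+ k * q ^- 'C(k, 2) * (q ^+ n / alpha) ^+ k.
Proof.
rewrite hornerZ horner_sum; congr (_ * _); apply: eq_bigr => k _.
rewrite hornerZ horner_prod.
have -> : \prod_(j < k) (1 - 'X * q%:P ^+ j).[x] = qpoch q x k.
  by apply: eq_bigr => j _; rewrite !hornerE.
by rewrite mulrC !mulrA [qpoch q x k * _]mulrC.
Qed.

(* The zeros in increasing order are listed, without repetition, by [rootsR];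
   zeros are numbered from 0. The default value 0 of the sequence access is
   only reached for j beyond the number of real zeros, hence never for j < n
   when 0 < q < 1 and 0 < alpha < q^-1. *)
Definition alSalamCarlitz2_zero (R : realType) (q : R) (n j : nat)
    (alpha : R) : R :=
  (rootsR (alSalamCarlitz2 q n alpha))`_j.

(* Main.v *)
(* For 0 < alpha < 1/q the V_n^(alpha) are orthogonal for the functional
   L_alpha f = sum_k w_alpha(k) f(q^-k), with weights w_alpha(k) > 0 whose ratio
   rho = w_beta / w_alpha is strictly increasing in k when alpha < beta. Let
   x_i, y_i be the zeros of V_n^(alpha), V_n^(beta), and suppose that
   y_j <= c := x_j. Put p = prod_(i < j) (X - x_i) prod_(i > j) (X - y_i), of
   degree n - 1. The polynomial (X - c) p^2 is nonnegative at all the x_i and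
   nonpositive at all the y_i, so Gauss quadrature (exact in degree 2n - 1)
   gives L_beta ((X - c) p^2) <= 0 <= L_alpha ((X - c) p^2). On the other hand,
   if K is the first index with q^-K >= c, then (rho(k) - rho(K)) (q^-k - c) >= 0
   for all k, hence L_beta ((X - c) p^2) > rho(K) L_alpha ((X - c) p^2) >= 0. *)
Require Import Defs.
From HB Require Import structures.
From mathcomp Require Import all_boot all_order all_algebra.
From mathcomp Require Import reals.
From mathcomp Require Import boolp classical_sets topology normedtype.
From mathcomp Require Import sequences ring lra.
From mathcomp.real_closed Require Import polyrcf.

Import Order.TTheory GRing.Theory Num.Theory.
Import numFieldNormedType.Exports.

Local Open Scope ring_scope.

(** * Real-rootedness and Gauss quadrature for an abstract positive functional *)

Lemma interpolation (F : fieldType) (s : seq F) (v : F -> F) : uniq s ->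
  exists2 u : {poly F}, (size u <= size s)%N & {in s, forall x, u.[x] = v x}.
Proof.
elim: s => [|z s IHs] /=; first by exists 0; rewrite ?size_poly0.
case/andP=> zNs /IHs[u su uE].
pose S := \prod_(y <- s) ('X - y%:P).
have Sz : S.[z] != 0 by rewrite -rootE root_prod_XsubC.
(* Newton's step: [S] vanishes at the earlier nodes but not at [z]. *)
exists (u + ((v z - u.[z]) / S.[z]) *: S) => [|x].
  rewrite (leq_trans (size_polyD _ _))// geq_max (leq_trans su)//=.
  by rewrite (leq_trans (size_scale_leq _ _))// size_prod_XsubC.
rewrite inE hornerD hornerZ => /predU1P[->|xs]; first by rewrite divfK// subrKC.
have /eqP-> : S.[x] == 0 by rewrite -rootE root_prod_XsubC.
by rewrite mulr0 addr0 uE.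
Qed.

Lemma dvd_prod_XsubC_roots (F : fieldType) (P : {poly F}) (s : seq F) :
  uniq s -> all (root P) s -> exists T, P = T * \prod_(z <- s) ('X - z%:P).
Proof. by move=> us rs; apply: uniq_roots_prod_XsubC; rewrite ?uniq_rootsE. Qed.

Lemma all_root_rootsR (R : rcfType) (P : {poly R}) :
  P != 0 -> all (root P) (rootsR P).
Proof.
by move=> P0; apply/allP => x; rewrite -roots_on_rootsR// => /andP[].
Qed.

(* If [P] had a double root, or a nonconstant factor without real roots, some
   [P * h] with [h] of lower degree would be nonnegative. *)
Lemma size_rootsR_orthogonal (R : rcfType) (L : {scalar {poly R}})
    (P : {poly R}) :
    (forall f : {poly R}, f != 0 -> (forall x, 0 <= f.[x]) -> 0 < L f) ->
    P != 0 ->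
    (forall h : {poly R}, (size h < size P)%N -> L (P * h) = 0) ->
  size P = (size (rootsR P)).+1.
Proof.
move=> Lpos P0 LP; set s := rootsR P.
have rootP0 x : root P x -> x \in s.
  by move=> rPx; rewrite -roots_on_rootsR.
have us : uniq s by exact: uniq_roots.
have [T PE] := dvd_prod_XsubC_roots _ _ _ us (all_root_rootsR _ _ P0).
rewrite -/s in PE; set S := \prod_(z <- s) _ in PE.
have S0 : S != 0 by rewrite monic_neq0// monic_prod_XsubC.
have T0 : T != 0 by apply: contraNneq P0 => T0; rewrite PE T0 mul0r.
have sizeP : size P = (size T + size s)%N.
  by rewrite PE size_Mmonic// ?monic_prod_XsubC// size_prod_XsubC addnS.
have Tnoroot x : ~~ root T x.
  apply/negP => rTx.
  have xs : x \in s by rewrite rootP0// PE rootM rTx.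
  have /factor_theorem[S1 S1E] : root S x by rewrite root_prod_XsubC.
  have /factor_theorem[T1 T1E] := rTx.
  have TS1 : P = ('X - x%:P) ^+ 2 * (T1 * S1).
    by rewrite PE T1E S1E; ring.
  have TS0 : T1 * S1 != 0 by apply: contraNneq P0 => h; rewrite TS1 h mulr0.
  (* Here [h] is [P / (X - x)^2], which makes [P h] a square. *)
  have : 0 < L (P * (T1 * S1)).
    have -> : P * (T1 * S1) = (('X - x%:P) * (T1 * S1)) ^+ 2.
      by rewrite TS1; ring.
    apply: Lpos => [|y]; last by rewrite horner_exp sqr_ge0.
    by rewrite expf_neq0// mulf_neq0// polyXsubC_eq0.
  rewrite LP ?ltxx// [ltnRHS](_ : _ = (size (T1 * S1)).+2) ?leqnSn//.
  have X2 := monic_exp 2 (monicXsubC x).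
  by rewrite [in LHS]TS1 (size_monicM X2) ?size_exp_XsubC.
have [sT|sT] := leqP (size T) 1.
  rewrite sizeP; move: T0 sT; rewrite -size_poly_gt0.
  by case: (size T) => [|[]].
(* Without real roots [T] keeps the sign it has at 0; with this sign, [P S] becomes [|T| S^2]
   pointwise. *)
have : 0 < L (P * (Num.sg T.[0] *: S)).
  apply: Lpos => [|x].
    by rewrite mulf_neq0// scaler_eq0 negb_or sgr_eq0 -rootE Tnoroot.
  have -> : Num.sg T.[0] = Num.sg T.[x].
    by apply: (@polyrN0_itv _ `]-oo, +oo[) => // y _.
  rewrite PE !(hornerM, hornerZ) mulrACA [_ * Num.sg _]mulrC -normrEsg.
  by rewrite mulr_ge0// -expr2 sqr_ge0.
rewrite LP ?ltxx// (leq_ltn_trans (size_scale_leq _ _))//.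
by rewrite size_prod_XsubC sizeP -[(size s).+1]add1n ltn_add2r.
Qed.

(* Gauss quadrature in disguise: [f] and the square of a polynomial [u] with
   [u^2 = f] at the nodes differ by a multiple of [P] of low degree. *)
Lemma orthogonal_ge0 (R : rcfType) (L : {scalar {poly R}})
    (P f : {poly R}) :
    (forall f : {poly R}, f != 0 -> (forall x, 0 <= f.[x]) -> 0 < L f) ->
    P != 0 -> size P = (size (rootsR P)).+1 ->
    (forall h : {poly R}, (size h < size P)%N -> L (P * h) = 0) ->
    (size f <= (size (rootsR P)).*2)%N ->
    {in rootsR P, forall x, 0 <= f.[x]} ->
  0 <= L f.
Proof.
move=> Lpos P0 sP LP sf f0.
have us : uniq (rootsR P) by exact: uniq_roots.
have [u su uE] := interpolation _ _ (fun x => Num.sqrt f.[x]) us.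
have [T PE] := dvd_prod_XsubC_roots _ _ _ us (all_root_rootsR _ _ P0).
have [|g gE] := @dvd_prod_XsubC_roots _ (f - u ^+ 2) _ us.
  apply/allP => x xs; rewrite rootE hornerD hornerN horner_exp uE//.
  by rewrite sqr_sqrtr ?f0// subrr.
set S := \prod_(z <- _) _ in PE gE.
have Sm : S \is monic by rewrite monic_prod_XsubC.
have sS : size S = (size (rootsR P)).+1 by rewrite size_prod_XsubC.
have T0 : T != 0 by apply: contraNneq P0 => T0; rewrite PE T0 mul0r.
have /size_poly1P[c c0 TE] : size T == 1.
  have := sP; rewrite {1}PE size_Mmonic// sS addnS /= => /eqP.
  by rewrite -add1n eqn_add2r.
have -> : f = P * (c^-1 *: g) + u ^+ 2.
  rewrite -[LHS](subrK (u ^+ 2)) gE PE TE mul_polyC -scalerAl -scalerAr.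
  by rewrite scalerA mulfV// scale1r mulrC.
rewrite linearD /= LP ?add0r.
  have [->|u0] := eqVneq u 0; first by rewrite expr0n linear0.
  by rewrite ltW// Lpos ?expf_neq0// => x; rewrite horner_exp sqr_ge0.
(* If [P] has n roots, [f - u^2] has degree below 2n, hence its cofactor [g] has degree below n, as
   orthogonality requires. *)
rewrite (leq_ltn_trans (size_scale_leq _ _))// sP ltnS.
have [->|g0] := eqVneq g 0; first by rewrite size_poly0.
have : (size (f - u ^+ 2)%R <= (size (rootsR P)).*2)%N.
  rewrite (leq_trans (size_polyD _ _))// geq_max sf size_polyN.
  rewrite expr2 (leq_trans (size_polyMleq _ _))// -addnn.
  by rewrite (leq_trans (leq_pred _))// leq_add.
by rewrite gE size_Mmonic// sS addnS /= -addnn leq_add2r.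
Qed.

(** * Convergence of series *)

Section AscSeries.
Local Open Scope classical_set_scope.

Lemma cvg_series_linear (R : realType) (c a b : R) (u v : nat -> R) :
  series u @ \oo --> a -> series v @ \oo --> b ->
  series (fun k => c * u k + v k) @ \oo --> c * a + b.
Proof.
move=> ua vb.
rewrite [X in X @ _](_ : _ = (fun n => c * series u n + series v n)).
  by apply: cvgD => //; apply: cvgM => //; exact: cvg_cst.
by apply/funext => n; rewrite /series/= mulr_sumr -big_split.
Qed.

Lemma cvg_series_gt0 (R : realType) (u : nat -> R) (l : R) k :
  (forall n, 0 <= u n) -> 0 < u k -> series u @ \oo --> l -> 0 < l.
Proof.
move=> u0 uk ul.
have nd : nondecreasing_seq (series u) by apply: nondecreasing_series.
have cu : cvgn (series u) by apply/cvg_ex; exists l.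
have := @nondecreasing_cvgn_le R _ nd cu k.+1.
rewrite (cvg_lim _ ul)//; apply: lt_le_trans.
by rewrite seriesSr ltr_wpDl// sumr_ge0.
Qed.

Lemma is_cvg_series_ratio_half (R : realType) (u : nat -> R) K :
  (forall n, 0 <= u n) -> (forall n, (K <= n)%N -> 2 * u n.+1 <= u n) ->
  cvgn (series u).
Proof.
move=> u0 uS.
have nd : nondecreasing_seq (series u) by apply: nondecreasing_series.
apply: nondecreasing_is_cvgn => //; exists (series u K + 2 * u K) => _ [n _ <-].
(* From [K] on, the partial sum plus twice the next term does not increase. *)
have bnd i : series u (K + i)%N + 2 * u (K + i)%N <= series u K + 2 * u K.
  elim: i => [|i]; first by rewrite addn0.
  apply: le_trans; rewrite addnS seriesSr.
  by have := uS (K + i)%N (leq_addr _ _); lra.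
apply: le_trans (nd _ _ (leq_addl K n)) _.
by apply: le_trans (bnd n); rewrite lerDl mulr_ge0.
Qed.

(* The weight alpha^k q^(k^2) / ((q; q)_k (alpha q; q)_k) at the node q^-k. *)
Definition asc_weight {R : realType} (q a : R) (k : nat) : R :=
  \prod_(i < k)
    (a * q ^+ i.*2.+1 / ((1 - q ^+ i.+1) * (1 - a * q ^+ i.+1))).

Lemma asc_weightS (R : realType) (q a : R) k : asc_weight q a k.+1 =
  asc_weight q a k *
    (a * q ^+ k.*2.+1 / ((1 - q ^+ k.+1) * (1 - a * q ^+ k.+1))).
Proof. by rewrite /asc_weight big_ord_recr. Qed.

(** Convergence is part of the predicate: [L] is summation against the weight over the nodes [q^-k],
    for every polynomial. *)
Definition asc_sum {R : realType} (q a : R) (L : {poly R} -> R) : Prop :=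
  forall f, series (fun k => asc_weight q a k * f.[q ^- k]) @ \oo --> L f.

(** * The functional of a single parameter and its Pearson relation *)

Section Weight.
Variables (R : realType) (q a : R).
Hypotheses (q0 : 0 < q) (q1 : q < 1) (a0 : 0 < a) (aq : a < q^-1).

Lemma subr1_exprS_gt0 k : 0 < 1 - q ^+ k.+1.
Proof. by rewrite subr_gt0 exprn_ilt1// ltW. Qed.

Lemma subr1_mul_exprS_gt0 k : 0 < 1 - a * q ^+ k.+1.
Proof.
rewrite subr_gt0 exprS mulrA.
apply: le_lt_trans (_ : a * q * 1 < 1).
  by rewrite ler_wpM2l ?mulr_ge0 ?(ltW a0) ?(ltW q0)// exprn_ile1// ltW.
by rewrite mulr1 -ltr_pdivlMr// mul1r.
Qed.

Lemma asc_weight_gt0 k : 0 < asc_weight q a k.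
Proof.
apply: prodr_gt0 => i _.
by rewrite divr_gt0 ?mulr_gt0 ?exprn_gt0 ?subr1_exprS_gt0 ?subr1_mul_exprS_gt0.
Qed.

(** The ratio of consecutive terms is at most [C q^k]: the denominators are smallest at k = 0, and
    [q^(2k+1) <= q^k]. So it eventually drops below 1/2. *)
Lemma is_cvg_series_asc_weight_exprn m :
  cvgn (series (fun k => asc_weight q a k * (q ^- k) ^+ m)).
Proof.
pose C := a * q ^- m / ((1 - q) * (1 - a * q)).
have [c1 c2] : 0 < 1 - q /\ 0 < 1 - a * q.
  by have := subr1_exprS_gt0 0; have := subr1_mul_exprS_gt0 0; rewrite expr1.
have C0 : 0 < C by rewrite divr_gt0 ?mulr_gt0 ?invr_gt0 ?exprn_gt0.
have [K _ hK] : \forall k \near \oo, 2 * C * q ^+ k < 1.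
  have /cvgrPdist_lt/(_ (2 * C)^-1) : (fun k => q ^+ k) @ \oo --> (0 : R).
    by apply: cvg_expr; rewrite gtr0_norm.
  have C2 : 0 < 2 * C by rewrite mulr_gt0.
  rewrite invr_gt0 C2 => /(_ isT); apply: filterS => k.
  rewrite sub0r normrN gtr0_norm ?exprn_gt0// => h.
  by rewrite -[ltRHS](mulfV (lt0r_neq0 C2)) ltr_pM2l.
apply: (@is_cvg_series_ratio_half _ _ K) => [n|n Kn].
  by rewrite mulr_ge0 ?exprn_ge0 ?invr_ge0 ?ltW ?asc_weight_gt0 ?exprn_gt0.
have -> : 2 * (asc_weight q a n.+1 * (q ^- n.+1) ^+ m) =
   (2 * (a * q ^+ n.*2.+1 / ((1 - q ^+ n.+1) * (1 - a * q ^+ n.+1))) * q ^- m)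
    * (asc_weight q a n * (q ^- n) ^+ m).
  by rewrite asc_weightS -!exprVn !exprS exprMn; ring.
rewrite ler_piMl//.
  by rewrite mulr_ge0 ?exprn_ge0 ?invr_ge0 ?ltW ?asc_weight_gt0 ?exprn_gt0.
apply: le_trans (ltW (hK n Kn)).
have -> : 2 * C * q ^+ n =
  2 * (a * (q ^+ n / ((1 - q) * (1 - a * q)))) * q ^- m by rewrite /C; ring.
rewrite ler_pM2r ?invr_gt0 ?exprn_gt0// ler_pM2l// -mulrA ler_pM2l//.
apply: ler_pM; rewrite ?exprn_ge0 ?invr_ge0 ?mulr_ge0 ?(ltW q0)//.
- exact/ltW/subr1_exprS_gt0.
- exact/ltW/subr1_mul_exprS_gt0.
- by rewrite ler_wiXn2l ?(ltW q0) ?(ltW q1)// -addnn -addnS leq_addr.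
rewrite lef_pV2 ?posrE ?mulr_gt0 ?subr1_exprS_gt0 ?subr1_mul_exprS_gt0//.
have h : q ^+ n.+1 <= q by rewrite exprS ler_piMr ?(ltW q0)// exprn_ile1// ltW.
apply: ler_pM; rewrite ?(ltW c1) ?(ltW c2)// lerD2l lerN2//.
by rewrite ler_wpM2l// ltW.
Qed.

Lemma asc_functional : {L : {scalar {poly R}} | asc_sum q a L}.
Proof.
have cf (f : {poly R}) :
    cvgn (series (fun k => asc_weight q a k * f.[q ^- k])).
  (* The extra power of the node is absorbed by the induction step [f X + c]. *)
  suff cfX m : cvgn (series (fun k =>
      asc_weight q a k * (f.[q ^- k] * (q ^- k) ^+ m))).
    rewrite [X in series X](_ : _ = fun k =>
      asc_weight q a k * (f.[q ^- k] * (q ^- k) ^+ 0)); first exact: cfX.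
    by apply/funext => k; rewrite mulr1.
  elim/poly_ind: f m => [m|f c IHf m].
    apply/cvg_ex; exists 0; rewrite [X in X @ _](_ : _ = fun=> 0).
      exact: cvg_cst.
    apply/funext => n; rewrite /series/= big1// => k _.
    by rewrite horner0 mul0r mulr0.
  have /cvg_ex[/= l1 h1] := IHf m.+1.
  have /cvg_ex[/= l2 h2] := is_cvg_series_asc_weight_exprn m.
  apply/cvg_ex; exists (c * l2 + l1).
  rewrite [X in X @ _](_ : _ = series (fun k =>
      c * (asc_weight q a k * (q ^- k) ^+ m) +
      asc_weight q a k * (f.[q ^- k] * (q ^- k) ^+ m.+1))).
    exact: cvg_series_linear.
  congr series; apply/funext => k.
  by move: (q ^- k) => x; rewrite !hornerE exprS /=; ring.
pose L (f : {poly R}) : R :=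
  limn (series (fun k => asc_weight q a k * f.[q ^- k])).
have Llin : GRing.linear_for *%R L.
  move=> c f g; apply: cvg_lim => //.
  rewrite [X in X @ _](_ : _ = series (fun k =>
    c * (asc_weight q a k * f.[q ^- k]) + asc_weight q a k * g.[q ^- k])).
    by apply: cvg_series_linear; apply: cf.
  congr series; apply/funext => k.
  by rewrite hornerD hornerZ mulrDr mulrCA.
pose M := GRing.isLinear.Build R {poly R} R *%R L Llin.
pose L' : {scalar {poly R}} := HB.pack L M.
exists L' => f; exact: cf.
Qed.

(* The hypothesis makes the series of [d] telescope: its partial sum up to [n]
   is [a q^n w(n) g(q^-n)]. *)
Lemma asc_functional_pearson (L : {scalar {poly R}}) (d g : {poly R}) :
  asc_sum q a L ->
  (forall x, x * d.[x] = a * g.[x] - (x - 1) * (x - a) * g.[q * x]) ->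
  L d = 0.
Proof.
move=> LE dE.
have SE n : series (fun k => asc_weight q a k * d.[q ^- k]) n.+1 =
    a * q ^+ n * (asc_weight q a n * g.[q ^- n]).
  elim: n => [|n IHn].
    rewrite /series/= big_nat1 /asc_weight big_ord0 expr0 invr1.
    (* The first node is 1, where the factor [x - 1] removes the term [g(q)]. *)
    by have := dE 1; rewrite subrr !mul0r subr0 !mul1r mulr1.
  rewrite seriesSr IHn.
  have qn0 : q ^+ n.+1 != 0 by rewrite expf_neq0// lt0r_neq0.
  have dn : d.[q ^- n.+1] =
      q ^+ n.+1 * (q ^- n.+1 * d.[q ^- n.+1]) by rewrite mulVKf.
  have qE : q * q ^- n.+1 = q ^- n by rewrite exprS invfM mulVKf// lt0r_neq0.
  (* The weight ratio makes the new term in [g(q^-n)] cancel the previous partial sum. *)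
  rewrite dn dE qE asc_weightS.
  have := lt0r_neq0 (subr1_exprS_gt0 n).
  have := lt0r_neq0 (subr1_mul_exprS_gt0 n).
  have -> : q ^+ n.*2.+1 = q ^+ n * q ^+ n.+1 by rewrite -addnn -addnS exprD.
  move: qn0; set y := q ^+ n.+1 => y0 h1 h2; field.
  by rewrite y0 h1 h2.
set u := (fun k => _) in SE.
(* The partial sums are [a q^n] times the general term of a convergent series. *)
suff u0 : series u @ \oo --> 0.
  by rewrite -(cvg_lim _ (LE d))//; exact: cvg_lim.
rewrite -cvg_shiftS [X in X @ _](_ : _ = fun n =>
    a * q ^+ n * (asc_weight q a n * g.[q ^- n])); last first.
  by apply/funext => n; exact: SE.
have aq0 : (fun n => a * q ^+ n) @ \oo --> a * 0.
  by apply: cvgM; [exact: cvg_cst | apply: cvg_expr; rewrite gtr0_norm].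
have u0 : (fun n => asc_weight q a n * g.[q ^- n]) @ \oo --> 0.
  by apply: cvg_series_cvg_0; apply/cvg_ex; exists (L g).
have := cvgM aq0 u0; rewrite mulr0 => lim0; exact: lim0.
Qed.
End Weight.

(** * The explicit polynomials, their shift relation and orthogonality *)

Lemma qpochS (A : comNzRingType) (q u : A) k :
  qpoch q u k.+1 = qpoch q u k * (1 - u * q ^+ k).
Proof. by rewrite /qpoch big_ord_recr. Qed.

Lemma horner_qpochX (R : comNzRingType) (q x : R) k :
  (qpoch q%:P 'X k).[x] = qpoch q x k.
Proof. by rewrite horner_prod; apply: eq_bigr => j _; rewrite !hornerE. Qed.

Lemma qpochSl (A : comNzRingType) (q u : A) k :
  qpoch q u k.+1 = (1 - u) * qpoch q (q * u) k.
Proof.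
rewrite /qpoch big_ord_recl mulr1; congr (_ * _).
by apply: eq_bigr => j _; rewrite exprS mulrA [u * q]mulrC.
Qed.

Lemma size_qpochX (R : idomainType) (q : R) k :
  q != 0 -> size (qpoch q%:P 'X k) = k.+1.
Proof.
move=> q0; elim: k => [|k IHk]; first by rewrite /qpoch big_ord0 size_poly1.
have s2 : size (1 - 'X * q%:P ^+ k : {poly R}) = 2%N.
  rewrite -polyC_exp mulrC mul_polyC addrC size_polyDl size_polyN.
    by rewrite size_scale ?expf_neq0// size_polyX.
  by rewrite size_scale ?expf_neq0// size_polyX size_poly1.
rewrite qpochS size_mul -?size_poly_gt0 ?IHk ?s2//.
by rewrite addn2.
Qed.

Definition asc_coef {R : realType} (q a : R) n k : R :=
  qpoch q (q ^- n) k / qpoch q q k * (-1) ^+ k * q ^- 'C(k, 2)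
    * (q ^+ n / a) ^+ k.

(** This is [V_n] without its nonzero scalar prefactor. *)
Definition asc_poly {R : realType} (q a : R) n : {poly R} :=
  \sum_(k < n.+1) asc_coef q a n k *: qpoch q%:P 'X k.

Section Poly.
Variables (R : realType) (q a : R).
Hypotheses (q0 : 0 < q) (q1 : q < 1) (a0 : 0 < a).

Lemma qpochq_neq0 k : qpoch q q k != 0.
Proof.
rewrite /qpoch; apply/prodf_neq0 => i _; apply: lt0r_neq0.
by rewrite -exprS subr1_exprS_gt0.
Qed.

(** Distributing the sign and the powers of q over [(q^-n; q)_k] turns each factor [1 - q^(j-n)]
    into [1 - q^(n-j)]. *)
Lemma asc_coefE n k : asc_coef q a n k =
  (\prod_(j < k) (1 - q ^+ n * q ^- j)) / qpoch q q k * a ^- k.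
Proof.
elim: k => [|k IHk].
  by rewrite /asc_coef /qpoch !big_ord0 bin0n !expr0 !divr1 !mulr1.
have -> : asc_coef q a n k.+1 = asc_coef q a n k *
    ((1 - q ^- n * q ^+ k) / (1 - q * q ^+ k) * (-1) * q ^- k * (q ^+ n / a)).
  by rewrite /asc_coef !qpochS !exprS binS bin1 exprD !invfM; ring.
rewrite IHk big_ord_recr/= qpochS exprS.
have := lt0r_neq0 (subr1_exprS_gt0 _ _ q0 q1 k); rewrite exprS.
have := qpochq_neq0 k; have := lt0r_neq0 a0.
have : q ^+ k != 0 by rewrite expf_neq0// lt0r_neq0.
have : q ^+ n != 0 by rewrite expf_neq0// lt0r_neq0.
have : a ^+ k != 0 by rewrite expf_neq0// lt0r_neq0.
by move=> h1 h2 h3 h4 h5 h6; field; rewrite h1 h2 h3 h4 h5 h6.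
Qed.

Lemma asc_coef0 n : asc_coef q a n 0 = 1.
Proof.
by rewrite asc_coefE big_ord0 /qpoch big_ord0 expr0 divr1 invr1 mulr1.
Qed.

Lemma asc_coef_gt n : asc_coef q a n n.+1 = 0.
Proof.
rewrite asc_coefE big_ord_recr/= mulfV ?subrr ?mulr0 ?mul0r//.
by rewrite expf_neq0// lt0r_neq0.
Qed.

(* Up to the factor [a ^- k] these are q-binomial coefficients, and this is the
   q-Pascal rule. *)
Lemma asc_coef_pascal n k : a * asc_coef q a n.+1 k.+1 =
  a * q ^+ k.+1 * asc_coef q a n k.+1 + asc_coef q a n k.
Proof.
rewrite !asc_coefE big_ord_recl [in RHS]big_ord_recr/= invr1 mulr1.
rewrite (eq_bigr (fun j : 'I_k => 1 - q ^+ n * q ^- j)); last first.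
  move=> j _; congr (1 - _); rewrite /bump/= add1n !exprS invfM.
  by rewrite mulrACA mulfV ?mul1r// lt0r_neq0.
rewrite qpochS !exprS; set p := \prod_(j < k) _.
have := lt0r_neq0 (subr1_exprS_gt0 _ _ q0 q1 k); rewrite exprS.
have := qpochq_neq0 k; have := lt0r_neq0 a0.
have : q ^+ k != 0 by rewrite expf_neq0// lt0r_neq0.
have : a ^+ k != 0 by rewrite expf_neq0// lt0r_neq0.
by move=> h1 h2 h3 h4 h5; field; rewrite h1 h2 h3 h4 h5.
Qed.

Lemma horner_asc_poly n x :
  (asc_poly q a n).[x] = \sum_(k < n.+1) asc_coef q a n k * qpoch q x k.
Proof.
rewrite horner_sum; apply: eq_bigr => k _.
by rewrite hornerZ horner_qpochX.
Qed.

(** This is the hypothesis of [asc_functional_pearson] with [g] the polynomial of index n, so it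
    yields orthogonality. On the right, each [(x; q)_k] contributes x times a combination of
    [(x; q)_k] and [(x; q)_(k+1)]; the coefficients match by [asc_coef_pascal]. *)
Lemma asc_poly_backward_shift n x : x * (a * (asc_poly q a n.+1).[x]) =
  a * (asc_poly q a n).[x] - (x - 1) * (x - a) * (asc_poly q a n).[q * x].
Proof.
rewrite !horner_asc_poly.
have phiE e k :
    a * (e * qpoch q x k) - (x - 1) * (x - a) * (e * qpoch q (q * x) k) =
    x * (a * q ^+ k * e * qpoch q x k) + x * (e * qpoch q x k.+1).
  have h : (x - 1) * qpoch q (q * x) k = - qpoch q x k.+1.
    by rewrite qpochSl; ring.
  transitivity (e * (a * qpoch q x k -
      (x - a) * ((x - 1) * qpoch q (q * x) k))); first by ring.
  by rewrite h qpochS; ring.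
rewrite !mulr_sumr -sumrB
  (eq_bigr _ (fun (k : 'I_n.+1) _ => phiE (asc_coef q a n k) k)).
(* The sum is extended to k = n + 1, where the coefficient vanishes, so that both sides have equal
   range. *)
rewrite big_split/= [X in _ = X + _](_ : _ = \sum_(k < n.+2)
   x * (a * q ^+ k * asc_coef q a n k * qpoch q x k)); last first.
  by rewrite [RHS]big_ord_recr/= asc_coef_gt mulr0 mul0r mulr0 addr0.
rewrite big_ord_recl [X in _ = X + _]big_ord_recl/= !asc_coef0 -addrA.
rewrite -big_split/= !expr0 !mulr1 mul1r; congr (_ + _).
apply: eq_bigr => k _; rewrite /bump/= add1n.
by rewrite [a * _]mulrA asc_coef_pascal; ring.
Qed.

Lemma size_asc_poly n : size (asc_poly q a n) = n.+1.
Proof.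
have qn0 := lt0r_neq0 q0.
rewrite /asc_poly big_ord_recr/= addrC.
have c0 : asc_coef q a n n != 0.
  rewrite asc_coefE !mulf_neq0 ?invr_neq0 ?qpochq_neq0//.
    apply/prodf_neq0 => j _.
    have jn : (j < n)%N by [].
    by rewrite -expfB// -(subnSK jn) lt0r_neq0// subr1_exprS_gt0.
  by rewrite expf_neq0// lt0r_neq0.
rewrite size_polyDl size_scale ?size_qpochX//.
apply: leq_ltn_trans (size_sum _ _ _) _; rewrite ltnS; apply/bigmax_leqP => k _.
by rewrite (leq_trans (size_scale_leq _ _))// size_qpochX.
Qed.

(** Induction on the index, tested on monomials: the Pearson relation for [P_m X^k] expresses
    [L (P_(m+1) X^k)] through [L (P_m X^(k-1))]. *)
Lemma asc_poly_orthogonal (L : {scalar {poly R}}) n (h : {poly R}) :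
  a < q^-1 -> asc_sum q a L -> (size h <= n)%N -> L (asc_poly q a n * h) = 0.
Proof.
move=> aq LE.
have LX m k : (k < m)%N -> L (asc_poly q a m * 'X^k) = 0.
  elim: m k => // m IHm k km.
  (* This is the Pearson expression for [P_m X^k] divided by x; the term in [P_m] carries the factor
     [q^k - 1], which is 0 when k = 0. *)
  pose d := a *: (q ^+ k *: (asc_poly q a m.+1 * 'X^k) -
     (if k is k'.+1 then (q ^+ k - 1) *: (asc_poly q a m * 'X^k') else 0)).
  have : L d = 0.
    pose g := asc_poly q a m * 'X^k.
    apply: (asc_functional_pearson _ q a _ _ _ _ _ d g) => // x; rewrite /g.
    have E : (x - 1) * (x - a) * (asc_poly q a m).[q * x] =
        a * (asc_poly q a m).[x] - x * (a * (asc_poly q a m.+1).[x]).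
      by rewrite asc_poly_backward_shift; ring.
    rewrite !hornerM !hornerXn [X in _ - X]mulrA E /d.
    case: k {km d g} => [|k]; first by rewrite !hornerE /=; ring.
    by rewrite !(hornerE, hornerXn) exprMn !exprS /=; ring.
  rewrite /d linearZ/= linearB/= linearZ/= => /eqP.
  have -> : L (if k is k'.+1 then (q ^+ k - 1) *: (asc_poly q a m * 'X^k')
               else 0) = 0.
    case: k km {d} => [|k] km; first exact: linear0.
    by rewrite linearZ/= IHm// mulr0.
  by rewrite subr0 !mulf_eq0 (gt_eqF a0) (gt_eqF (exprn_gt0 k q0)) => /eqP.
move=> hn; rewrite -[h]coefK poly_def mulr_sumr linear_sum big1// => i _.
by rewrite -scalerAr linearZ/= LX ?mulr0// (leq_trans (ltn_ord i)).
Qed.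
End Poly.

(** * Comparison of the functionals of two parameters *)

Lemma asc_weight_ratio_incr (R : realType) (q a b : R) :
  0 < q -> q < 1 -> 0 < a -> a < b -> b < q^-1 ->
  {homo (fun k => asc_weight q b k / asc_weight q a k) :
    i j / (i < j)%N >-> i < j}.
Proof.
move=> q0 q1 a0 ab bq.
have b0 := lt_trans a0 ab; have aq := lt_trans ab bq.
apply: homo_ltn => [x y z|k]; first exact: lt_trans.
have wa := asc_weight_gt0 _ _ _ q0 q1 a0 aq k.
have wb := asc_weight_gt0 _ _ _ q0 q1 b0 bq k.
have ha := subr1_mul_exprS_gt0 _ _ _ q0 q1 a0 aq k.
have hb := subr1_mul_exprS_gt0 _ _ _ q0 q1 b0 bq k.
have hq := subr1_exprS_gt0 _ _ q0 q1 k.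
have qk : 0 < q ^+ k.*2.+1 by rewrite exprn_gt0.
rewrite !asc_weightS; set y := q ^+ k.+1 in ha hb hq *.
(* The growth factor of the ratio exceeds 1 because [b - a b y > a - a b y]. *)
have -> : asc_weight q b k * (b * q ^+ k.*2.+1 / ((1 - y) * (1 - b * y))) /
    (asc_weight q a k * (a * q ^+ k.*2.+1 / ((1 - y) * (1 - a * y)))) =
    asc_weight q b k / asc_weight q a k * (b * (1 - a * y) / (a * (1 - b * y))).
  by field; rewrite !lt0r_neq0.
rewrite ltr_pMr ?divr_gt0// ltr_pdivlMr ?mulr_gt0// mul1r.
by rewrite !mulrBr !mulr1 mulrCA ltrD2r.
Qed.

(** Among [size f] distinct nodes one is not a root; [N] allows it to be taken beyond a given
    index. *)
Lemma exists_node_neq0 (R : realType) (q : R) (f : {poly R}) N :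
  0 < q -> q < 1 -> f != 0 -> exists2 k, (N <= k)%N & f.[q ^- k] != 0.
Proof.
move=> q0 q1 f0.
pose s := [seq q ^- k | k <- iota N (size f)].
have us : uniq s.
  rewrite map_inj_uniq ?iota_uniq// => k l /invr_inj.
  by apply: ieexprIn; rewrite ?lt_eqF.
have : ~~ all (root f) s.
  apply/negP => fs; have := max_poly_roots f0 fs us.
  by rewrite size_map size_iota ltnn.
case/allPn => x /mapP[k]; rewrite mem_iota => /andP[Nk _] -> fk.
by exists k.
Qed.

Lemma exists_node_ge (R : realType) (q c : R) :
  0 < q -> q < 1 -> exists k, c <= q ^- k.
Proof.
move=> q0 q1; have c0 : 0 < `|c| + 1 by rewrite ltr_wpDl.
have /cvgrPdist_lt/(_ (`|c| + 1)^-1) : (fun k => q ^+ k) @ \oo --> (0 : R).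
  by apply: cvg_expr; rewrite gtr0_norm.
rewrite invr_gt0 c0 => /(_ isT)[k _ /(_ k (leqnn k))/=].
rewrite sub0r normrN gtr0_norm ?exprn_gt0// => h; exists k.
rewrite (le_trans (ler_norm c))// -[leLHS]addr0.
rewrite (le_trans (_ : _ <= `|c| + 1)) ?lerD2l// -[leLHS]invrK.
by rewrite lef_pV2 ?posrE ?invr_gt0 ?exprn_gt0// ltW.
Qed.

Lemma asc_functional_gt0 (R : realType) (q a : R) (L : {scalar {poly R}})
    (f : {poly R}) :
  0 < q -> q < 1 -> 0 < a -> a < q^-1 ->
  asc_sum q a L ->
  f != 0 -> (forall x, 0 <= f.[x]) -> 0 < L f.
Proof.
move=> q0 q1 a0 aq LE f0 fge0.
have w0 := asc_weight_gt0 _ _ _ q0 q1 a0 aq.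
have [k _ fk] := exists_node_neq0 _ _ _ 0 q0 q1 f0.
apply: (cvg_series_gt0 _ _ _ k _ _ (LE f)) => [m|].
  by rewrite mulr_ge0// ltW.
by rewrite mulr_gt0// lt_def fk fge0.
Qed.

Lemma asc_functional_lt (R : realType) (q a b c : R)
    (La Lb : {scalar {poly R}}) (p : {poly R}) :
  0 < q -> q < 1 -> 0 < a -> a < b -> b < q^-1 ->
  asc_sum q a La -> asc_sum q b Lb ->
  p != 0 -> 0 <= La (('X - c%:P) * (p * p)) ->
  0 < Lb (('X - c%:P) * (p * p)).
Proof.
move=> q0 q1 a0 ab bq LaE LbE p0; set f := _ * _ => Laf.
have wa := asc_weight_gt0 _ _ _ q0 q1 a0 (lt_trans ab bq).
have wb := asc_weight_gt0 _ _ _ q0 q1 (lt_trans a0 ab) bq.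
pose rho k := asc_weight q b k / asc_weight q a k.
have rho_incr : {homo rho : i j / (i < j)%N >-> i < j}.
  exact: asc_weight_ratio_incr.
have nodes_incr : {homo (fun k => q ^- k) : i j / (i < j)%N >-> i < j}.
  by move=> i j ij; rewrite ltf_pV2 ?posrE ?exprn_gt0// ltr_iXn2l.
case: (ex_minnP (exists_node_ge _ _ c q0 q1)) => K cK Kmin.
(* The series of [u] sums to [Lb f - rho(K) La f]. By minimality of [K], the factors [rho k - rho K]
   and [q^-k - c] never have opposite signs. *)
pose u k := - rho K * (asc_weight q a k * f.[q ^- k]) +
  asc_weight q b k * f.[q ^- k].
have uE k : u k =
    (rho k - rho K) * (q ^- k - c) * (asc_weight q a k * p.[q ^- k] ^+ 2).
  rewrite /u; have -> : asc_weight q b k = rho k * asc_weight q a k.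
    by rewrite divfK// lt0r_neq0.
  by rewrite /f !hornerM hornerXsubC; ring.
have u0 k : 0 <= u k.
  rewrite uE; apply: mulr_ge0; last by rewrite mulr_ge0 ?sqr_ge0// ltW.
  have [kK|Kk|->] := ltngtP k K; last by rewrite subrr mul0r.
    rewrite mulr_le0// subr_le0 ?ltW ?rho_incr// ltNge.
    by apply/negP => /Kmin; rewrite leqNgt kK.
  by rewrite mulr_ge0// subr_ge0 ?(le_trans cK) ?ltW ?rho_incr ?nodes_incr.
(* Starting at [K + 1] makes both factors strictly positive, even if [q^-K = c]. *)
have [k Kk pk] := exists_node_neq0 _ _ _ K.+1 q0 q1 p0.
have uk : 0 < u k.
  have pk2 : 0 < p.[q ^- k] ^+ 2 by rewrite exprn_even_gt0.
  rewrite uE; apply: mulr_gt0; last exact: mulr_gt0.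
  apply: mulr_gt0; first by rewrite subr_gt0 rho_incr.
  by rewrite subr_gt0 (le_lt_trans cK)// nodes_incr.
have := cvg_series_linear _ (- rho K) _ _ _ _ (LaE f) (LbE f).
move=> /(cvg_series_gt0 _ _ _ _ u0 uk).
rewrite mulNr addrC subr_gt0; apply: le_lt_trans.
by rewrite mulr_ge0// divr_ge0// ltW.
Qed.

End AscSeries.

(** * Comparison of the zeros *)

Theorem proposition3p8 (R : realType) (q : R) (hq0 : 0 < q) (hq1 : q < 1)
    (n : nat) (hn : (1 <= n)%N) (j : 'I_n) :
  {in `]0, q^-1[ &,
    {homo alSalamCarlitz2_zero q n j : alpha beta / alpha < beta}}.
Proof.
move=> a b; rewrite !in_itv/= => /andP[a0 aq] /andP[b0 bq] ab.
(* Size at most [n.*2] means degree at most 2n - 1, the exactness range of Gauss quadrature. *)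
have facts c : 0 < c -> c < q^-1 -> exists L : {scalar {poly R}},
    let P := alSalamCarlitz2 q n c in
    [/\ asc_sum q c L,
        size (rootsR P) = n &
        forall f : {poly R}, (size f <= n.*2)%N ->
          {in rootsR P, forall x, 0 <= f.[x]} -> 0 <= L f].
  move=> c0 cq; have [L LE] := asc_functional _ _ _ hq0 hq1 c0 cq.
  exists L => P.
  pose e := (- c) ^+ n * q ^- 'C(n, 2).
  have e0 : e != 0.
    by rewrite mulf_neq0 ?invr_eq0 ?expf_neq0 ?oppr_eq0 ?lt0r_neq0.
  have PE : P = e *: asc_poly q c n by [].
  have sP : size P = n.+1 by rewrite PE size_scale// size_asc_poly.
  have P0 : P != 0 by rewrite -size_poly_eq0 sP.
  have Lpos := asc_functional_gt0 _ _ _ _ _ hq0 hq1 c0 cq LE.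
  have LP (h : {poly R}) : (size h < size P)%N -> L (P * h) = 0.
    rewrite sP ltnS => sh; rewrite PE -scalerAl linearZ/=.
    by rewrite (asc_poly_orthogonal _ _ _ hq0 hq1 c0 _ _ _ cq LE sh) mulr0.
  have sr := size_rootsR_orthogonal _ _ _ Lpos P0 LP.
  have srn : size (rootsR P) = n by apply: succn_inj; rewrite -sr.
  split=> // f sf; apply: (orthogonal_ge0 _ _ _ _ Lpos P0 sr LP).
  by rewrite srn.
have [La [LaE sx La0]] := facts a a0 aq.
have [Lb [LbE sy Lb0]] := facts b b0 bq.
rewrite /alSalamCarlitz2_zero.
set xs := rootsR _ in sx La0 *; set ys := rootsR _ in sy Lb0 *.
have root_le (P : {poly R}) i k : size (rootsR P) = n -> (i <= k < n)%N ->
    (rootsR P)`_i <= (rootsR P)`_k.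
  move=> sP /andP[ik kn].
  by rewrite lt_sorted_leq_nth ?sorted_roots// inE sP// (leq_ltn_trans ik).
rewrite ltNge; apply/negP => yx; set c := xs`_j in yx.
(* The j smallest zeros for [a] and the n - 1 - j largest for [b], so that [f] has degree exactly 2n
   - 1. *)
pose s := take j xs ++ drop j.+1 ys.
pose p : {poly R} := \prod_(z <- s) ('X - z%:P).
pose f := ('X - c%:P) * (p * p).
have p0 : p != 0 by rewrite monic_neq0// monic_prod_XsubC.
have fE x : f.[x] = (x - c) * p.[x] ^+ 2 by rewrite /f !hornerM hornerXsubC.
have ps x : x \in s -> p.[x] = 0.
  by move=> xs0; apply/eqP; rewrite -rootE root_prod_XsubC.
have sf : size f = n.*2.
  rewrite (_ : f = \prod_(z <- c :: s ++ s) ('X - z%:P)); last first.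
    by rewrite big_cons big_cat.
  rewrite size_prod_XsubC /= !size_cat size_takel; last by rewrite sx ltnW.
  by rewrite size_drop sy addnn -doubleS -addnS subnSK// subnKC// ltnW.
(* At the zeros for [a], either [p] vanishes (i < j) or the zero is at least [c]. *)
have Laf : 0 <= La f.
  apply: La0 => [|_ /(nthP 0)[i + <-]]; first by rewrite sf.
  rewrite sx fE => ilt; have [ij|ji] := ltnP i j.
    rewrite ps ?expr0n ?mulr0// mem_cat -(nth_take 0 ij) mem_nth//.
    by rewrite size_takel// sx ltnW.
  by rewrite mulr_ge0 ?sqr_ge0// subr_ge0 root_le// ji.
have := asc_functional_lt _ _ _ _ _ _ _ _ hq0 hq1 a0 ab bq LaE LbE p0 Laf.
rewrite -/f ltNge -oppr_ge0 -linearN /= => /negP; apply.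
(* At the zeros for [b], either the zero is at most [ys_j <= c] or [p] vanishes (i > j), so
   quadrature applies to [-f]. *)
apply: Lb0 => [|_ /(nthP 0)[i + <-]]; first by rewrite size_polyN sf.
rewrite sy hornerN fE -mulNr opprB => ilt; have [ij|ji] := leqP i j.
  rewrite mulr_ge0 ?sqr_ge0// subr_ge0 (le_trans _ yx)// root_le//.
  by rewrite ij ltn_ord.
rewrite ps ?expr0n ?mulr0// mem_cat; apply/orP; right.
rewrite -(subnKC ji) -nth_drop mem_nth// size_drop sy.
by rewrite ltn_sub2r// (leq_ltn_trans ji).
Qed.
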